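(* Let $R$ be a ring of positive characteristic, and let $G$ be a locally finite $p$-group. Then the group ring $RG$ is a $W\sqrt{J}U$ ring if and only if one of the following holds: (1) $R$ is a $\sqrt{J}U$ ring and $G$ is a $2$-group. (2) $R$ is a $W\sqrt{J}U$ ring with $3\in J(R)$, and $G$ is a $3$-group. (3) $R\cong R_1\times R_2$, where $R_1$ is a $\sqrt{J}U$ ring, $R_2$ is a $W\sqrt{J}U$ ring, and $G$ is the trivial group.
   Context: Rings are associative with identity, not necessarily commutative. For a ring $A$, $U(A)$ is its group of units, $J(A)$ its Jacobson radical, and $\sqrt{J(A)}=\{x\in A : x^n\in J(A)\text{ for some } n\ge 1\}$. A ring $A$ is $\sqrt{J}U$ if $U(A)=1+\sqrt{J(A)}$. A ring $A$ is $W\sqrt{J}U$ (weakly $\sqrt{J}U$) if $U(A)=\pm 1+\sqrt{J(A)}$, which means that every unit of $A$ can be written as $j+1$ or as $j-1$ for some $j\in\sqrt{J(A)}$. $RG$ denotes the group ring of the group $G$ over $R$. Here $p$ is a prime, and for a prime $q$, a $q$-group is a group in which every element has order a power of $q$. A group is locally finite if every subgroup generated by a finite subset is finite. An integer $m$ is regarded as the element $m\cdot 1_A$ of a ring $A$. *)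

(* Defs.v *)
From HB Require Import structures.
From mathcomp Require Import all_boot all_algebra.
From mathcomp Require Import finmap monalg.

Set Implicit Arguments.
Unset Strict Implicit.
Unset Printing Implicit Defensive.

Import GRing.Theory.
Local Open Scope fset_scope.
Local Open Scope ring_scope.

Section Rings.
Context (A : nzRingType).

Definition is_unit (u : A) : Prop := exists v : A, u * v = 1 /\ v * u = 1.

Definition left_ideal (I : A -> Prop) : Prop :=
  [/\ I 0, forall x y, I x -> I y -> I (x + y) & forall a x, I x -> I (a * x)].

Definition maximal_left_ideal (I : A -> Prop) : Prop :=
  [/\ left_ideal I, ~ I 1 &
      forall K : A -> Prop, left_ideal K -> ~ K 1 ->
        (forall x, I x -> K x) -> forall x, K x -> I x].

Definition jacobson (x : A) : Prop :=
  forall I : A -> Prop, maximal_left_ideal I -> I x.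

Definition sqrt_jacobson (x : A) : Prop :=
  exists n : nat, (0 < n)%N /\ jacobson (x ^+ n).

Definition sqrtJU : Prop :=
  forall u : A, is_unit u <-> exists2 j, sqrt_jacobson j & u = 1 + j.

(* The reverse implication is automatic: if j ^+ n is in J(A), then j + 1 and
   j - 1 are units. *)
Definition weakly_sqrtJU : Prop :=
  forall u : A, is_unit u ->
    exists2 j, sqrt_jacobson j & u = j + 1 \/ u = j - 1.

(* Not [pchar A], which only records prime characteristics. *)
Definition positive_characteristic : Prop :=
  exists n : nat, (0 < n)%N /\ n%:R = 0 :> A.

End Rings.

Arguments sqrtJU A : clear implicits.
Arguments weakly_sqrtJU A : clear implicits.
Arguments positive_characteristic A : clear implicits.

Section Groups.
Context (G : groupType).
Local Open Scope group_scope.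

Definition subgroup (H : G -> Prop) : Prop :=
  [/\ H 1, forall x y, H x -> H y -> H (x * y) & forall x, H x -> H x^-1].

Definition generated (s : seq G) (x : G) : Prop :=
  forall H : G -> Prop, subgroup H -> (forall y, y \in s -> H y) -> H x.

Definition locally_finite : Prop :=
  forall s : seq G, exists t : seq G, forall x, generated s x -> x \in t.

Definition has_order (x : G) (n : nat) : Prop :=
  [/\ (0 < n)%N, x ^+ n = 1 & forall m, (0 < m < n)%N -> x ^+ m <> 1].

Definition is_qgroup (q : nat) : Prop :=
  forall x : G, exists k : nat, has_order x (q ^ k)%N.

Definition trivial_group : Prop := forall x : G, x = 1.

End Groups.

Arguments locally_finite G : clear implicits.
Arguments is_qgroup G q : clear implicits.
Arguments trivial_group G : clear implicits.

(* Finitely supported functions G -> R, with the convolution product. The ring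
   structure that [monalg] puts on {malg R[K]} is not available here: it
   requires a [monomType], in which x * y = 1 forces x = y = 1. *)
Definition group_ring (R : nzRingType) (G : groupType) : Type := {malg R[G]}.

Section GroupRing.
Context (R : nzRingType) (G : groupType).
Local Notation RG := (group_ring R G).

HB.instance Definition _ := GRing.Zmodule.on RG.

Implicit Types (x y z : RG) (g h : G).

Definition gr_one : RG := << 1 *g 1%g >>.

Definition gr_mul x y : RG :=
  \sum_(g <- msupp x) \sum_(h <- msupp y) << x@_g * y@_h *g (g * h)%g >>.

Lemma gr_mulw (d1 d2 : {fset G}) x y :
  msupp x `<=` d1 -> msupp y `<=` d2 ->
  gr_mul x y = \sum_(g <- d1) \sum_(h <- d2) << x@_g * y@_h *g (g * h)%g >>.
Proof.
move=> le1 le2; rewrite /gr_mul (big_fset_incl _ le1) /=.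
  apply/eq_bigr=> k1 _; apply/big_fset_incl => // k _ /mcoeff_outdom ->.
  by rewrite mulr0 monalgU0.
move=> k _ /mcoeff_outdom xk.
by rewrite big1 => // k' _; rewrite xk mul0r monalgU0.
Qed.

Lemma gr_mul0l y : gr_mul 0 y = 0.
Proof. by rewrite /gr_mul msupp0 big_seq_fset0. Qed.

Lemma gr_mul0r x : gr_mul x 0 = 0.
Proof. by rewrite /gr_mul big1 // => g _; rewrite msupp0 big_seq_fset0. Qed.

Lemma gr_mulDl : left_distributive gr_mul +%R.
Proof.
move=> x y z.
rewrite (@gr_mulw (msupp x `|` msupp y) (msupp z) (x + y)) ?msuppD_le //.
rewrite (@gr_mulw (msupp x `|` msupp y) (msupp z) x) ?fsubsetUl //.
rewrite (@gr_mulw (msupp x `|` msupp y) (msupp z) y) ?fsubsetUr //.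
rewrite -big_split /=; apply/eq_bigr=> g _.
rewrite -big_split /=; apply/eq_bigr=> h _.
by rewrite mcoeffD mulrDl monalgUD.
Qed.

Lemma gr_mulDr : right_distributive gr_mul +%R.
Proof.
move=> x y z.
rewrite (@gr_mulw (msupp x) (msupp y `|` msupp z) x (y + z)) ?msuppD_le //.
rewrite (@gr_mulw (msupp x) (msupp y `|` msupp z) x y) ?fsubsetUl //.
rewrite (@gr_mulw (msupp x) (msupp y `|` msupp z) x z) ?fsubsetUr //.
rewrite -big_split /=; apply/eq_bigr=> g _.
rewrite -big_split /=; apply/eq_bigr=> h _.
by rewrite mcoeffD mulrDr monalgUD.
Qed.

Lemma gr_mulUU a b g h :
  gr_mul << a *g g >> << b *g h >> = << a * b *g (g * h)%g >>.
Proof. by rewrite (gr_mulw msuppU_le msuppU_le) !big_seq_fset1 !mcoeffUU. Qed.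

Lemma gr_mul_suml I (s : seq I) (F : I -> RG) y :
  gr_mul (\sum_(i <- s) F i) y = \sum_(i <- s) gr_mul (F i) y.
Proof.
exact: (big_morph (gr_mul^~ y) (fun a b => gr_mulDl a b y) (gr_mul0l y)).
Qed.

Lemma gr_mul_sumr I (s : seq I) (F : I -> RG) x :
  gr_mul x (\sum_(i <- s) F i) = \sum_(i <- s) gr_mul x (F i).
Proof. exact: (big_morph (gr_mul x) (gr_mulDr x) (gr_mul0r x)). Qed.

Lemma gr_mulA : associative gr_mul.
Proof.
move: gr_mul gr_mul_suml gr_mul_sumr gr_mulUU => m ml mr mU x y z.
rewrite (monalgE x) !ml; apply/eq_bigr=> g _.
rewrite (monalgE y) ml !mr ml; apply/eq_bigr=> h _.
rewrite (monalgE z) !mr; apply/eq_bigr=> k _.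
by rewrite !mU mulrA mulgA.
Qed.

Lemma gr_mul1l : left_id gr_one gr_mul.
Proof.
move=> x; rewrite (monalgE x) gr_mul_sumr; apply/eq_bigr=> g _.
by rewrite gr_mulUU mul1r mul1g.
Qed.

Lemma gr_mul1r : right_id gr_one gr_mul.
Proof.
move=> x; rewrite (monalgE x) gr_mul_suml; apply/eq_bigr=> g _.
by rewrite gr_mulUU mulr1 mulg1.
Qed.

Lemma gr_one_neq0 : gr_one != 0.
Proof. by rewrite monalgU_eq0 oner_eq0. Qed.

HB.instance Definition _ := GRing.Zmodule_isNzRing.Build RG
  gr_mulA gr_mul1l gr_mul1r gr_mulDl gr_mulDr gr_one_neq0.

End GroupRing.

(* Main.v *)
Require Import Defs.
From HB Require Import structures.
From mathcomp Require Import all_boot all_algebra all_fingroup all_solvable.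
From mathcomp Require Import boolp classical_sets finmap monalg.

Set Implicit Arguments.
Unset Strict Implicit.
Unset Printing Implicit Defensive.

Import GRing.Theory.
Local Open Scope ring_scope.

(** Let u be a unit of RG.  The augmentation RG -> R, which is split by the
    constants, carries a representation u = j + 1 or u = j - 1 down to R, so R
    is weakly [sqrtJU] as soon as RG is.  In the other direction such a
    representation lifts through any surjection with nil kernel, because nil
    ideals lie in the Jacobson radical ([weakly_sqrtJU_lift]).  The
    augmentation ideal is nil when G is a locally finite p-group and p is
    nilpotent in R ([augmentation_kernel_nil]): an element of it involves a
    finite subgroup H only, and any long enough product of factors h - 1, with
    h in H, vanishes.  The latter is a fact about finite groups: functions from
    H to Z/q, for q a power of p, have a finite p-group of affine
    transformations generated by the translations and by H, and the nilpotency
    of that group says that iterated differences h v - v reach 0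
    ([difference_word_nilpotent], [augmentation_word_nilpotent]).

    Only the primes 2 and 3 can occur in the characteristic of a weakly
    [sqrtJU] ring ([weakly_sqrtJU_char]): where 2 is invertible, it must be 1 or
    -1 up to the radical, so that 3 is in the radical.  Hence 2 ^ a * 3 ^ b = 0
    in R, and an integer e splits R into eR, where 2 is nilpotent, and (1 - e)R,
    where 3 is nilpotent.  In the first factor -1 is 1 up to the radical, so
    that factor is [sqrtJU].  If G is trivial, the statement is the discussion
    of which of the two factors vanish; when neither does, they are the R1 and
    R2 of the third case.

    If G contains g <> 1, of order a power of p, the factor of R on which the
    prime q is nilpotent vanishes for q <> p ([torsion_idempotent_zero]).
    Indeed g or - g is unipotent up to the radical, and for q = 2 both are, so
    that g may be taken; its order is invertible on that factor.  A root of
    unity of invertible order that differs from 1 by an element nilpotent modulo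
    the radical equals 1 ([root_of_unity_sqrt_jacobson]), and comparing
    coefficients in RG kills the factor.  As R is nonzero, this leaves p = 2
    with 2 nilpotent in R, or p = 3 with 3 nilpotent in R. *)

(** * The Jacobson radical and its square root *)

Section Jacobson.
Variable A : nzRingType.
Implicit Types (a b c f u x y z j : A) (I K M : A -> Prop).

(** Zorn's lemma is applied to the proper left ideals above [I] together with
    the empty set, which is the union of the empty chain. *)
Lemma maximal_left_ideal_above I : left_ideal I -> ~ I 1 ->
  exists2 M, maximal_left_ideal M & forall x, I x -> M x.
Proof.
move=> idI I1.
pose P (X : set A) := X = set0 \/
  [/\ left_ideal X, ~ X 1 & forall x, I x -> X x].
have [|M [PM maxM]] := @Zorn_bigcup A P.
  move=> F FP totF.
  have [[X0 [FX0 X0n]]|Fempty] := pselect (exists X, F X /\ X <> set0);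
    last first.
    left; apply/seteqP; split=> // x [X FX Xx]; exfalso; apply: Fempty.
    by exists X; split=> // X0; rewrite X0 in Xx.
  have good X x : F X -> X x -> [/\ left_ideal X, ~ X 1 & forall x, I x -> X x].
    by move=> /FP[->|].
  have [[x0 Xx0]|] := pselect (exists x, X0 x); last first.
    move=> e; case: X0n; apply/seteqP; split=> // x Xx; case: e; by exists x.
  have [[X00 _ _] _ IX0] := good _ _ FX0 Xx0.
  right; split; [split=> [|x y [X FX Xx] [Y FY Yy]|a x [X FX Xx]] | | ].
  - by exists X0.
  - have [XY|YX] := totF _ _ FX FY.
      exists Y => //; have [[_ D _] _ _] := good _ _ FY Yy.
      by apply: D => //; apply: XY.
    exists X => //; have [[_ D _] _ _] := good _ _ FX Xx.
    by apply: D => //; apply: YX.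
  - by exists X => //; have [[_ _ D] _ _] := good _ _ FX Xx; apply: D.
  - by move=> [X FX X1]; have [_ nX1 _] := good _ _ FX X1; apply: nX1.
  - by move=> x Ix; exists X0 => //; apply: IX0.
have [I0 _ _] := idI.
case: PM => [M0|[idM M1 IM]].
  case: (maxM I); last by right.
  by split=> [x|IM]; [rewrite M0|have := IM 0 I0; rewrite M0].
exists M => //; split=> // K idK K1 MK x Kx.
apply: contrapT => Mx; case: (maxM K); last first.
  by right; split=> // y Iy; apply/MK/IM.
by split=> // KM; apply/Mx/KM.
Qed.

(** The description of the radical by left invertibility is the form that
    passes along ring morphisms and gives units. *)
Lemma jacobsonP x : jacobson x <-> forall a, exists b, b * (1 - a * x) = 1.
Proof.
split=> [Jx a|linv M [idM M1 maxM]].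
  pose I y := exists b, y = b * (1 - a * x).
  have idI : left_ideal I.
    split=> [|y z [b ->] [c ->]|b y [c ->]].
    - by exists 0; rewrite mul0r.
    - by exists (b + c); rewrite mulrDl.
    - by exists (b * c); rewrite mulrA.
  apply: contrapT => nI; have [|M maxM IM] := maximal_left_ideal_above idI.
    by move=> [b e]; apply: nI; exists b.
  have [[_ MD MM] M1 _] := maxM; apply: M1.
  rewrite -(subrK (a * x) 1); apply: MD; last exact: MM (Jx _ maxM).
  by apply: IM; exists 1; rewrite mul1r.
apply: contrapT => Mx; have [M0 MD MM] := idM.
pose K y := exists m a, M m /\ y = m + a * x.
case: (pselect (K 1)) => [[m [a [Mm e]]]|K1].
  have [b] := linv a; rewrite e addrK => be.
  by apply: M1; rewrite e -be; apply: MM.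
apply: Mx; apply: (maxM K) => //.
- split=> [|y z [m [a [Mm ->]]] [n [b [Mn ->]]]|b y [m [a [Mm ->]]]].
  + by exists 0, 0; rewrite mul0r addr0.
  + by exists (m + n), (a + b); rewrite mulrDl addrACA; split=> //; apply: MD.
  + by exists (b * m), (b * a); rewrite mulrDr mulrA; split=> //; apply: MM.
- by move=> y My; exists y, 0; rewrite mul0r addr0.
- by exists 0, 1; rewrite mul1r add0r.
Qed.

Lemma jacobson0 : jacobson (0 : A).
Proof. by move=> I [[]]. Qed.

Lemma jacobsonD x y : jacobson x -> jacobson y -> jacobson (x + y).
Proof.
move=> Jx Jy I maxI; have [[_ ID _] _ _] := maxI.
by apply: ID; [exact: Jx|exact: Jy].
Qed.

Lemma jacobsonMl a x : jacobson x -> jacobson (a * x).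
Proof.
by move=> Jx I maxI; have [[_ _ IM] _ _] := maxI; apply: IM (Jx _ maxI).
Qed.

(** If [c] is a left inverse of [1 - b * a * x], then [1 + a * x * c * b] is one
    of [1 - a * x * b]: both are the geometric series. *)
Lemma jacobsonMr x b : jacobson x -> jacobson (x * b).
Proof.
move=> /jacobsonP Jx; apply/jacobsonP => a; have [c e] := Jx (b * a).
exists (1 + a * x * c * b).
rewrite mulrDl mul1r.
have -> : a * x * c * b * (1 - a * (x * b)) = a * x * (c * (1 - b * a * x)) * b.
  by rewrite !(mulrBr, mulrBl, mulr1, mulrA).
by rewrite e mulr1 mulrA subrK.
Qed.

Lemma jacobsonN x : jacobson x -> jacobson (- x).
Proof. by rewrite -mulN1r; apply: jacobsonMl. Qed.

Lemma is_unitN u : is_unit u -> is_unit (- u).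
Proof. by case=> v [uv vu]; exists (- v); rewrite !mulrNN. Qed.

Lemma jacobson_unit x : jacobson x -> is_unit (1 + x).
Proof.
move=> Jx; have [c] := (jacobsonP x).1 Jx (-1).
rewrite mulN1r opprK => ec; exists c; split=> //.
have Jy : jacobson (c * x) by apply: jacobsonMl.
have [d] := (jacobsonP _).1 Jy 1.
have -> : 1 - 1 * (c * x) = c by rewrite mul1r -{1}ec mulrDr mulr1 addrK.
move=> ed; have -> // : 1 + x = d.
by rewrite -[LHS]mul1r -{1}ed -mulrA ec mulr1.
Qed.

Lemma sqrt_jacobsonN x : sqrt_jacobson x -> sqrt_jacobson (- x).
Proof.
move=> [n [n0 Jn]]; exists n; split=> //.
by rewrite exprNn; apply: jacobsonMl.
Qed.

Lemma sqrt_jacobsonM x y : GRing.comm x y ->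
  sqrt_jacobson x -> sqrt_jacobson (x * y).
Proof.
move=> xy [n [n0 Jn]]; exists n; split=> //.
by rewrite exprMn_comm //; apply: jacobsonMr.
Qed.

Lemma sqrt_jacobsonD x z : sqrt_jacobson x -> jacobson z ->
  sqrt_jacobson (x + z).
Proof.
move=> [n [n0 Jn]] Jz; exists n; split=> //.
suff: jacobson ((x + z) ^+ n - x ^+ n).
  by move=> J; rewrite -[X in jacobson X](subrK (x ^+ n)); apply: jacobsonD.
elim: n {n0 Jn} => [|n IH]; first by rewrite subrr; apply: jacobson0.
rewrite !exprS mulrDl -addrAC -mulrBr.
by apply: jacobsonD; [apply: jacobsonMl|apply: jacobsonMr].
Qed.

(** For [y = - x], the product of [1 - y] with the geometric sum of [y] is
    [1 - y ^+ n], which is a unit for [y ^+ n] in the radical. *)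
Lemma sqrt_jacobson_unit x : sqrt_jacobson x -> is_unit (1 + x).
Proof.
move=> /sqrt_jacobsonN [n [n0 Jn]].
have [v [e1 e2]] := jacobson_unit (jacobsonN Jn).
rewrite -[x]opprK; move: (- x) Jn v e1 e2 => y Jn v e1 e2.
pose s := \sum_(i < n) y ^+ i.
have es : (1 - y) * s = 1 - y ^+ n.
  by rewrite -opprB mulNr -subrX1 opprB.
have cs : GRing.comm (1 - y) s.
  apply: commr_sum => i _; apply: commrX; apply/commr_sym.
  by apply: commrB => //; apply: commr1.
have se : s * (1 - y) = 1 - y ^+ n by rewrite -cs es.
exists (s * v); split; first by rewrite mulrA es.
suff -> : s * v = v * s by rewrite -mulrA se.
rewrite -[LHS]mul1r -e2 -mulrA; congr (_ * _).
have -> : (1 - y ^+ n) * (s * v) = s * ((1 - y ^+ n) * v).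
  rewrite !mulrA; congr (_ * _); by rewrite -{1}es cs -mulrA es.
by rewrite e1 mulr1.
Qed.

(** A central element that is nilpotent modulo the radical generates a nil
    ideal modulo the radical, and such an ideal vanishes. *)
Lemma central_sqrt_jacobson z : (forall a, GRing.comm z a) ->
  sqrt_jacobson z -> jacobson z.
Proof.
move=> cz Sz; apply/jacobsonP => a.
have [|v [_ e]] := @sqrt_jacobson_unit (- (a * z)); last by exists v.
by apply: sqrt_jacobsonN; rewrite -cz; apply: sqrt_jacobsonM.
Qed.

Lemma nilpotent_sqrt_jacobson x n : x ^+ n = 0 -> sqrt_jacobson x.
Proof.
move=> xn; exists n.+1; split=> //; rewrite exprS xn mulr0.
exact: jacobson0.
Qed.

Lemma idempotent_sqrt_jacobson f : f * f = f -> sqrt_jacobson f -> f = 0.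
Proof.
move=> ff /sqrt_jacobsonN /sqrt_jacobson_unit [v [e _]].
by rewrite -[f]mulr1 -e mulrA mulrBr mulr1 ff subrr mul0r.
Qed.

(** Recording the sign as [(-1) ^+ s] lets a ring morphism act on both cases
    of the definition at once. *)
Lemma weakly_sqrtJUP : weakly_sqrtJU A <-> forall u, is_unit u ->
  exists s : bool, sqrt_jacobson (u - (-1) ^+ s).
Proof.
split=> W u /W.
  move=> [j Sj [->|->]]; first by exists false; rewrite addrK.
  by exists true; rewrite expr1 opprK subrK.
move=> [s S]; exists (u - (-1) ^+ s) => //; case: s {S}.
  by right; rewrite expr1 opprK addrK.
by left; rewrite subrK.
Qed.

Lemma sqrtJU_weakly : sqrtJU A -> weakly_sqrtJU A.
Proof. by move=> S u /S [j Sj ->]; exists j => //; left; rewrite addrC. Qed.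

(** When 2 is in the radical the two signs agree: [j - 1 = (j - 2) + 1]. *)
Lemma weakly_sqrtJU_jacobson2 :
  weakly_sqrtJU A -> jacobson (2%:R : A) -> sqrtJU A.
Proof.
move=> W J2 u; split=> [|[j Sj ->]]; last exact: sqrt_jacobson_unit.
move=> /W [j Sj [->|->]]; first by exists j; rewrite // addrC.
exists (j - 2%:R); first by apply: sqrt_jacobsonD => //; apply: jacobsonN.
by rewrite mulr2n opprD [RHS]addrC -!addrA addNr addr0.
Qed.

End Jacobson.

(** * Ring morphisms and products *)

Lemma surjective_jacobson (A B : nzRingType) (f : {rmorphism A -> B}) x :
  (forall b, exists a, f a = b) -> jacobson x -> jacobson (f x).
Proof.
move=> surj /jacobsonP Jx; apply/jacobsonP => b.
have [a <-] := surj b; have [c e] := Jx a.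
by exists (f c); rewrite -(rmorph1 f) -rmorphM -rmorphB -rmorphM e rmorph1.
Qed.

Lemma surjective_sqrt_jacobson (A B : nzRingType) (f : {rmorphism A -> B}) x :
  (forall b, exists a, f a = b) -> sqrt_jacobson x -> sqrt_jacobson (f x).
Proof.
move=> surj [n [n0 Jn]]; exists n; split=> //.
by rewrite -rmorphXn; apply: surjective_jacobson.
Qed.

(** Units are required to lift because a surjection need not be surjective on
    units. *)
Lemma weakly_sqrtJU_push (A B : nzRingType) (f : {rmorphism A -> B}) :
  (forall b, exists a, f a = b) ->
  (forall u, is_unit u -> exists2 w, is_unit w & f w = u) ->
  weakly_sqrtJU A -> weakly_sqrtJU B.
Proof.
move=> surj unitlift /weakly_sqrtJUP W.
apply/weakly_sqrtJUP => _ /unitlift[w Uw <-].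
have [s S] := W w Uw; exists s.
by rewrite -(rmorph_sign f) -rmorphB; apply: surjective_sqrt_jacobson.
Qed.

(** A left inverse of [1 - f a * f x] lifts to a left inverse of [1 - a * x] up
    to an element [1 + d] with [d] nilpotent. *)
Lemma nil_kernel_jacobson (A B : nzRingType) (f : {rmorphism A -> B}) x :
  (forall b, exists a, f a = b) ->
  (forall d, f d = 0 -> exists n, d ^+ n = 0) ->
  jacobson (f x) -> jacobson x.
Proof.
move=> surj nil /jacobsonP Jx; apply/jacobsonP => a.
have [b' e] := Jx (f a); have [b eb] := surj b'; rewrite -{}eb in e.
have [|n dn] := nil (b * (1 - a * x) - 1).
  by rewrite rmorphB rmorphM rmorphB rmorphM rmorph1 e subrr.
have [v [_ ev]] := sqrt_jacobson_unit (nilpotent_sqrt_jacobson dn).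
exists (v * b); rewrite -[RHS]ev -mulrA; congr (v * _).
by rewrite [RHS]addrC subrK.
Qed.

Lemma weakly_sqrtJU_lift (A B : nzRingType) (f : {rmorphism A -> B}) :
  (forall b, exists a, f a = b) ->
  (forall d, f d = 0 -> exists n, d ^+ n = 0) ->
  weakly_sqrtJU B -> weakly_sqrtJU A.
Proof.
move=> surj nil /weakly_sqrtJUP W; apply/weakly_sqrtJUP => u [v [uv vu]].
have [|s [n [n0 Jn]]] := W (f u).
  by exists (f v); rewrite -!rmorphM uv vu rmorph1.
exists s; exists n; split=> //; apply: (nil_kernel_jacobson surj nil).
by rewrite rmorphXn rmorphB rmorph_sign.
Qed.

(** Both signs are available for every unit, since [u] and [- u] are units. *)
Lemma sqrtJU_sign (A : nzRingType) : sqrtJU A -> forall u : A, is_unit u ->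
  forall s : bool, sqrt_jacobson (u - (-1) ^+ s).
Proof.
move=> S u Uu []; last by have [j Sj ->] := (S u).1 Uu; rewrite addrC addKr.
have [j Sj e] := (S _).1 (is_unitN Uu).
rewrite expr1 opprK -[u]opprK e opprD addrAC addNr add0r.
exact: sqrt_jacobsonN.
Qed.

(** The unit -1 is [1 + j], so -2 is nilpotent modulo the radical; and it is
    central. *)
Lemma sqrtJU_jacobson2 (A : nzRingType) : sqrtJU A -> jacobson (2%:R : A).
Proof.
move=> S; have U1 : is_unit (1 : A) by exists 1; rewrite mulr1.
apply: central_sqrt_jacobson; first by move=> x; apply/commr_sym/commr_nat.
by have := sqrtJU_sign S U1 true; rewrite expr1 opprK.
Qed.

Lemma pair_jacobson (A B : nzRingType) (x : A) (y : B) :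
  jacobson x -> jacobson y -> jacobson ((x, y) : (A * B)%type).
Proof.
move=> /jacobsonP Jx /jacobsonP Jy; apply/jacobsonP => -[a b].
have [c ec] := Jx a; have [d ed] := Jy b.
by exists (c, d); congr pair.
Qed.

Lemma jacobsonX (A : nzRingType) (x : A) n :
  (0 < n)%N -> jacobson x -> jacobson (x ^+ n).
Proof. by case: n => // n _ Jx; rewrite exprS; apply: jacobsonMr. Qed.

Lemma pair_sqrt_jacobson (A B : nzRingType) (x : A) (y : B) :
  sqrt_jacobson x -> sqrt_jacobson y -> sqrt_jacobson ((x, y) : (A * B)%type).
Proof.
move=> [n [n0 Jn]] [m [m0 Jm]].
exists (n * m)%N; rewrite muln_gt0 n0 m0; split=> //.
have -> k : ((x, y) : (A * B)%type) ^+ k = (x ^+ k, y ^+ k).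
  by elim: k => [|k IH]; rewrite ?expr0 // !exprS IH.
by apply: pair_jacobson; [|rewrite mulnC]; rewrite exprM; apply: jacobsonX.
Qed.

(** The sign is dictated by the second factor; the first one tolerates both. *)
Lemma weakly_sqrtJU_prod (A B : nzRingType) :
  sqrtJU A -> weakly_sqrtJU B -> weakly_sqrtJU (A * B)%type.
Proof.
move=> S /weakly_sqrtJUP W.
apply/weakly_sqrtJUP => -[u v] [[u' v'] [[e1 e2] [e3 e4]]].
have [|s Sv] := W v; first by exists v'.
exists s.
have -> : (u, v) - (-1) ^+ s = (u - (-1) ^+ s, v - (-1) ^+ s) by case: s {Sv}.
apply: pair_sqrt_jacobson => //; apply: sqrtJU_sign => //.
by exists u'.
Qed.

(** * Rings of positive characteristic *)

Section Characteristic.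
Variable A : nzRingType.

Lemma commr_natl (a : A) n : GRing.comm n%:R a.
Proof. exact/commr_sym/commr_nat. Qed.

Lemma natr_eq_mod (N k l : nat) :
  N%:R = 0 :> A -> k = l %[mod N] -> k%:R = l%:R :> A.
Proof.
move=> N0 e; rewrite (divn_eq k N) (divn_eq l N) e.
by rewrite !natrD !natrM N0 !mulr0.
Qed.

(** The idempotent is an integer multiple of 1, hence central, and keeps its
    properties under every ring morphism. *)
Lemma coprime_idempotent m n : coprime m n -> (m * n)%:R = 0 :> A ->
  exists e : nat, [/\ m%:R * e%:R = 0 :> A, n%:R * (1 - e%:R) = 0 :> A &
    e%:R * e%:R = e%:R :> A].
Proof.
move=> co mn0; pose e := chinese m n 1 0.
have em : e = 1 %[mod m] by apply: chinese_modl.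
have /dvdnP[x ex] : (n %| e)%N by rewrite /dvdn chinese_modr // mod0n.
have m0 : m%:R * e%:R = 0 :> A.
  by rewrite -natrM ex mulnCA natrM mn0 mulr0.
have n0 : n%:R * (1 - e%:R) = 0 :> A.
  rewrite mulrBr mulr1 -natrM; apply/eqP; rewrite subr_eq0; apply/eqP.
  apply: natr_eq_mod mn0 _.
  by rewrite ![(m * n)%N]mulnC -{1}[n]muln1 -!muln_modr em.
exists e; split=> //; apply/eqP.
rewrite -subr_eq0 -{3}[e%:R]mulr1 -mulrBr -opprB.
by rewrite mulrN {1}ex natrM -mulrA n0 mulr0 oppr0.
Qed.

(** An integer prime to the characteristic [m] of the factor [e A] is
    invertible there. *)
Lemma idempotent_inverse m k e : coprime m k -> m%:R * e = 0 :> A ->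
  exists l : nat, l%:R * k%:R * e = e.
Proof.
move=> co me; exists (chinese m k 1 0 %/ k)%N.
have kd : (k %| chinese m k 1 0)%N by rewrite /dvdn chinese_modr // mod0n.
rewrite -natrM divnK //; have := chinese_modl co 1 0.
move: (chinese m k 1 0) => c cm.
have c1 : c%:R * e = (c %% m)%:R * e.
  by rewrite {1}(divn_eq c m) natrD natrM mulrDl -mulrA me mulr0 add0r.
have e1 : 1%:R * e = (1 %% m)%:R * e.
  by rewrite {1}(divn_eq 1 m) natrD natrM mulrDl -mulrA me mulr0 add0r.
by rewrite c1 cm -e1 mul1r.
Qed.

(** Let [e] cut out the part of [A] whose characteristic is prime to 6.  The
    unit [1 + e] is 2 there and 1 elsewhere; subtracting 1 or -1 from it and
    restricting to the part of [e] leaves 1 or 3, both of them units there, so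
    that [e] itself is nilpotent modulo the radical, and [e = 0]. *)
Lemma weakly_sqrtJU_char : positive_characteristic A -> weakly_sqrtJU A ->
  exists a b : nat, (2 ^ a * 3 ^ b)%:R = 0 :> A.
Proof.
move=> [N [N0 cN]] /weakly_sqrtJUP W.
have [m2 co2 eN] := pfactor_coprime (isT : prime 2) N0.
have m20 : (0 < m2)%N by move: N0; rewrite eN; case: (m2).
have [m co3 em] := pfactor_coprime (isT : prime 3) m20.
have {}co2 : coprime m 2.
  by move: co2; rewrite em coprime_sym coprimeMl => /andP[].
have {}co3 : coprime m 3 by rewrite coprime_sym.
set b := logn 3 m2 in em; set a := logn 2 N in eN; exists a, b.
pose n := (2 ^ a * 3 ^ b)%N.
have co : coprime m n by rewrite coprimeMr !coprimeXr.
have mn0 : (m * n)%:R = 0 :> A by rewrite /n mulnCA mulnC -em -eN.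
have [e [me ne ee]] := coprime_idempotent co mn0.
have [h he] := idempotent_inverse co2 me.
have ce x : GRing.comm e%:R x := commr_natl x e.
have Ue : is_unit (1 + e%:R : A).
  (* The inverse is h = 1/2 on the part of e and 1 elsewhere. *)
  exists (1 + (h%:R - 1) * e%:R).
  have eh : e%:R * h%:R = h%:R * e%:R :> A by rewrite ce.
  have he2 : h%:R * e%:R + h%:R * e%:R = e%:R :> A.
    by rewrite -[RHS]he -mulrDl; congr (_ * _); rewrite mulr_natr mulr2n.
  have hee : h%:R * e%:R * e%:R = h%:R * e%:R :> A by rewrite -mulrA ee.
  have inv : (1 + e%:R) * (1 + (h%:R - 1) * e%:R) = 1 :> A.
    rewrite mulrDr mulr1 mulrBl mul1r mulrDl mul1r mulrBr mulrA eh hee ee.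
    by rewrite [X in _ + X]addrACA he2 [X in _ + X]addrA subrr add0r addrK.
  split=> //; rewrite -[RHS]inv; apply: commrD; first exact: commr1.
  by apply/commr_sym; apply: ce.
suff e0 : e%:R = 0 :> A by move: ne; rewrite e0 subr0 mulr1.
apply: idempotent_sqrt_jacobson => //.
have [[] Se] := W _ Ue; last by rewrite [1 + _]addrC addrK in Se.
have [k ke] := idempotent_inverse co3 me.
have -> : e%:R = (1 + e%:R - (-1) ^+ true) * (k%:R * e%:R) :> A.
  rewrite expr1 opprK [1 + _]addrC -addrA mulrA -[X in X * _]commr_natl -mulrA.
  rewrite mulrDl ee -[X in X + _]mul1r -mulrDl -[in LHS]ke -mulrA.
  by congr (_ * (_ * _)); rewrite -!natrD.
apply: sqrt_jacobsonM => //; rewrite -natrM; apply/commr_sym/commr_natl.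
Qed.

Lemma nilpotent_nat_jacobson q c :
  (q ^ c)%:R = 0 :> A -> jacobson (q%:R : A).
Proof.
move=> qc; apply: central_sqrt_jacobson; first by move=> x; apply: commr_natl.
by apply: (@nilpotent_sqrt_jacobson _ _ c); rewrite -natrX.
Qed.

(** The prime-to-[p] part of the characteristic has a multiple of the form
    [1 + k * p], which is a unit when [p] is in the radical. *)
Lemma prime_jacobson_nilpotent p : prime p -> positive_characteristic A ->
  jacobson (p%:R : A) -> exists k, p%:R ^+ k = 0 :> A.
Proof.
move=> pp [N [N0 cN]] Jp; have [m co eN] := pfactor_coprime pp N0.
exists (logn p N); rewrite -natrX; set q := (p ^ _)%N in eN *.
have m0 : (0 < m)%N by move: N0; rewrite eN; case: (m).
have [l _] := Bezoutl p m0; rewrite gcdnC (eqP co) => /dvdnP[k ek].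
have [v [_ ev]] := jacobson_unit (jacobsonMl l%:R Jp).
rewrite -[LHS]mul1r -{1}ev -mulrA -natrM -(natrD _ 1) ek -natrM -mulnA -eN.
by rewrite natrM cN !mulr0.
Qed.

Lemma geometric_sum_comm (u : A) n : exists2 t, GRing.comm u t &
  \sum_(i < n) u ^+ i = n%:R + (u - 1) * t.
Proof.
elim: n => [|n [t ct IH]].
  by exists 0; [exact: commr0|rewrite big_ord0 mulr0 addr0].
exists (t + \sum_(i < n) u ^+ i).
  by apply: commrD => //; apply: commr_sum => i _; apply: commrX.
rewrite big_ord_recr /= [in LHS]IH mulrDr -subrX1 -addn1 natrD addrACA -addrA.
by rewrite -addrA; congr (_ + (_ + _)); rewrite addrC subrK.
Qed.

(** On the factor [e A], where [m] is invertible with inverse [k], the element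
    [1 + u + ... + u ^+ m.-1] differs from [m] by a multiple of [u - 1], so it
    is a unit as soon as [u - 1] is nilpotent modulo the radical; but its
    product with [u - 1] is [u ^+ m - 1 = 0]. *)
Lemma root_of_unity_sqrt_jacobson (u e : A) m k : (forall x, GRing.comm e x) ->
  e * e = e -> u ^+ m = 1 -> k%:R * m%:R * e = e ->
  sqrt_jacobson (e * (u - 1)) -> e * (u - 1) = 0.
Proof.
move=> ce ee um ke Sy; have [t ct es] := geometric_sum_comm u m.
set y := e * (u - 1) in Sy *.
have ey : e * y = y by rewrite /y mulrA ee.
have yS : y * \sum_(i < m) u ^+ i = 0.
  by rewrite /y -mulrA -subrX1 um subrr mulr0.
have cyt : GRing.comm y (k%:R * t).
  apply: commrM; first exact: commr_nat.
  apply/commr_sym; apply: commrM; first by apply/commr_sym/ce.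
  by apply: commrB; [apply/commr_sym|apply: commr1].
have [v [e1 _]] := sqrt_jacobson_unit (sqrt_jacobsonM cyt Sy).
suff y0 : y * (1 + y * (k%:R * t)) = 0 by rewrite -[y]mulr1 -e1 mulrA y0 mul0r.
have -> : y * (1 + y * (k%:R * t)) = k%:R * (y * \sum_(i < m) u ^+ i).
  have kmy : k%:R * (y * m%:R) = y.
    by rewrite commr_nat mulrA -{1}ey mulrA ke.
  have yy : y * y = y * (u - 1) by rewrite {2}/y mulrA -ce ey.
  clearbody y; rewrite es !mulrDr mulr1 kmy; congr (_ + _).
  rewrite !mulrA yy -!mulrA [in RHS]commr_natl -!mulrA.
  by congr (_ * (_ * _)); apply: commr_natl.
by rewrite yS mulr0.
Qed.

End Characteristic.

(** * Corner rings at a central idempotent *)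

Definition central_idempotent (R : nzRingType) (e : R) : Prop :=
  (forall x, GRing.comm e x) /\ e * e = e.

Lemma central_idempotentC (R : nzRingType) (e : R) :
  central_idempotent e -> central_idempotent (1 - e).
Proof.
case=> ce ee; split=> [x|]; last first.
  by rewrite mulrBr mulr1 mulrBl mul1r ee subrr subr0.
by apply/commr_sym/commrB; [apply: commr1|apply/commr_sym/ce].
Qed.

(** The proofs are part of the type so that the ring structure, with unit [e]
    and the nontriviality axiom, can be attached to it. *)
Definition corner (R : nzRingType) (e : R) (_ : central_idempotent e)
  (_ : e <> 0) : Type := {x : R | e * x == x}.

Section Corner.
Variables (R : nzRingType) (e : R) (ec : central_idempotent e) (e0 : e <> 0).
Local Notation C := (corner ec e0).

HB.instance Definition _ := Choice.copy C {x : R | e * x == x}.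

Definition corner_val (x : C) : R := sval x.
Definition to_corner (x : R) : C.
Proof. by exists (e * x); rewrite mulrA (proj2 ec). Defined.

Lemma corner_valK (x : C) : e * corner_val x = corner_val x.
Proof. exact/eqP/(svalP x). Qed.

Lemma corner_inj : injective corner_val.
Proof. by move=> x y; apply: val_inj. Qed.

Lemma to_cornerE x : corner_val (to_corner x) = e * x.
Proof. by []. Qed.

Local Definition corner_zero := to_corner 0.
Local Definition corner_one := to_corner 1.
Local Definition corner_opp x := to_corner (- corner_val x).
Local Definition corner_add x y := to_corner (corner_val x + corner_val y).
Local Definition corner_mul x y := to_corner (corner_val x * corner_val y).

Lemma corner_addE x y :
  corner_val (corner_add x y) = corner_val x + corner_val y.
Proof. by rewrite to_cornerE mulrDr !corner_valK. Qed.
Lemma corner_mulE x y :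
  corner_val (corner_mul x y) = corner_val x * corner_val y.
Proof. by rewrite to_cornerE mulrA corner_valK. Qed.
Lemma corner_oneE : corner_val corner_one = e.
Proof. by rewrite to_cornerE mulr1. Qed.

Local Lemma corner_addA : associative corner_add.
Proof. by move=> x y z; apply: corner_inj; rewrite !corner_addE addrA. Qed.
Local Lemma corner_addC : commutative corner_add.
Proof. by move=> x y; apply: corner_inj; rewrite !corner_addE addrC. Qed.
Local Lemma corner_add0 : left_id corner_zero corner_add.
Proof.
by move=> x; apply: corner_inj; rewrite corner_addE to_cornerE mulr0 add0r.
Qed.
Local Lemma corner_addN : left_inverse corner_zero corner_opp corner_add.
Proof.
move=> x; apply: corner_inj.
by rewrite corner_addE !to_cornerE mulrN corner_valK addNr mulr0.
Qed.

HB.instance Definition _ := GRing.isZmodule.Build C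
  corner_addA corner_addC corner_add0 corner_addN.

Local Lemma corner_mulA : associative corner_mul.
Proof. by move=> x y z; apply: corner_inj; rewrite !corner_mulE mulrA. Qed.
Local Lemma corner_mul1l : left_id corner_one corner_mul.
Proof.
by move=> x; apply: corner_inj; rewrite corner_mulE corner_oneE corner_valK.
Qed.
Local Lemma corner_mul1r : right_id corner_one corner_mul.
Proof.
move=> x; apply: corner_inj; rewrite corner_mulE corner_oneE.
by rewrite -(proj1 ec) corner_valK.
Qed.
Local Lemma corner_mulDl : left_distributive corner_mul corner_add.
Proof.
move=> x y z; apply: corner_inj.
by rewrite corner_addE !corner_mulE corner_addE mulrDl.
Qed.
Local Lemma corner_mulDr : right_distributive corner_mul corner_add.
Proof.
move=> x y z; apply: corner_inj.
by rewrite corner_addE !corner_mulE corner_addE mulrDr.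
Qed.
Local Lemma corner_one0 : corner_one != corner_zero.
Proof.
apply/eqP => /(congr1 corner_val); rewrite corner_oneE to_cornerE mulr0.
exact: e0.
Qed.

HB.instance Definition _ := GRing.Zmodule_isNzRing.Build C corner_mulA
  corner_mul1l corner_mul1r corner_mulDl corner_mulDr corner_one0.

Lemma to_corner_zmod : zmod_morphism to_corner.
Proof.
move=> x y; apply: corner_inj; rewrite [RHS]corner_addE !to_cornerE.
by rewrite mulrN !mulrA (proj2 ec) mulrBr.
Qed.

Lemma to_corner_monoid : monoid_morphism to_corner.
Proof.
split=> // x y; apply: corner_inj; rewrite [RHS]corner_mulE !to_cornerE.
by rewrite [RHS]mulrA -[e * x * e]mulrA -(proj1 ec x) !mulrA (proj2 ec).
Qed.

HB.instance Definition _ :=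
  GRing.isZmodMorphism.Build R C to_corner to_corner_zmod.
HB.instance Definition _ :=
  GRing.isMonoidMorphism.Build R C to_corner to_corner_monoid.

Lemma to_corner_surj (c : C) : exists x, to_corner x = c.
Proof.
by exists (corner_val c); apply: corner_inj; rewrite to_cornerE corner_valK.
Qed.

(** A unit of the corner is completed to a unit of [R] by [1 - e]. *)
Lemma corner_unit_lift (u : C) :
  is_unit u -> exists2 w, is_unit w & to_corner w = u.
Proof.
move=> [v [uv vu]].
have inv (x y : C) : x * y = 1 ->
    (corner_val x + (1 - e)) * (corner_val y + (1 - e)) = 1.
  move=> /(congr1 corner_val); rewrite [LHS]corner_mulE corner_oneE => exy.
  have xf (z : C) : corner_val z * (1 - e) = 0.
    by rewrite mulrBr mulr1 -(proj1 ec) corner_valK subrr.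
  have fx (z : C) : (1 - e) * corner_val z = 0.
    by rewrite mulrBl mul1r corner_valK subrr.
  have ff : (1 - e) * (1 - e) = 1 - e.
    by rewrite mulrBr mulr1 mulrBl mul1r (proj2 ec) subrr subr0.
  move: (1 - e) (subrK e 1) xf fx ff => f fe xf fx ff.
  by rewrite mulrDl !mulrDr exy xf fx ff add0r addr0 addrC.
exists (corner_val u + (1 - e)).
  by exists (corner_val v + (1 - e)); split; apply: inv.
apply: corner_inj.
rewrite to_cornerE mulrDr corner_valK mulrBr mulr1 (proj2 ec).
by rewrite subrr addr0.
Qed.

Lemma corner_weakly : weakly_sqrtJU R -> weakly_sqrtJU C.
Proof.
exact: (@weakly_sqrtJU_push _ _ to_corner to_corner_surj corner_unit_lift).
Qed.

End Corner.
Arguments to_corner {R e} ec e0 x : simpl never.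

Lemma corner_natr0 (R : nzRingType) (e : R) (ec : central_idempotent e)
  (e0 : e <> 0) n :
  n%:R * e = 0 -> n%:R = 0 :> corner ec e0.
Proof.
move=> ne; rewrite -(rmorph_nat (to_corner ec e0)); apply: corner_inj.
by rewrite !to_cornerE mulr0 (proj1 ec).
Qed.

Lemma corner_decomposition (R : nzRingType) (e : R)
  (ec : central_idempotent e) (e0 : e <> 0)
  (fc : central_idempotent (1 - e)) (f0 : 1 - e <> 0) :
  exists f : {rmorphism R -> (corner ec e0 * corner fc f0)%type}, bijective f.
Proof.
pose g (x : R) : (corner ec e0 * corner fc f0)%type :=
  (to_corner ec e0 x, to_corner fc f0 x).
have gz : zmod_morphism g by move=> x y; rewrite /g !rmorphB.
have gm : monoid_morphism g by split=> [|x y]; rewrite /g ?rmorph1 ?rmorphM.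
pose Gz := GRing.isZmodMorphism.Build _ _ g gz.
pose Gm := GRing.isMonoidMorphism.Build _ _ g gm.
pose G : {rmorphism R -> (corner ec e0 * corner fc f0)%type} := HB.pack g Gz Gm.
exists G.
exists (fun c => corner_val c.1 + corner_val c.2).
  move=> x; change (e * x + (1 - e) * x = x).
  by rewrite mulrBl mul1r addrC subrK.
move=> [x y]; congr pair; apply: corner_inj;
  rewrite to_cornerE mulrDr corner_valK.
  rewrite -[corner_val y]corner_valK mulrA mulrBr mulr1 (proj2 ec) subrr.
  by rewrite mul0r addr0.
rewrite -[corner_val x]corner_valK mulrA mulrBl mul1r (proj2 ec) subrr.
by rewrite mul0r add0r.
Qed.

(** * Nilpotency of the augmentation ideal of a finite p-group *)

Section AffineGroup.
Variables (gT : finGroupType) (q : nat).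
Local Notation V := {ffun gT -> 'Z_q}.

Definition translation (v : V) : {perm V} := perm (@addIr V v).

(** Right translation of functions, as a right action of [gT]: permutations
    compose from left to right. *)
Definition shift (h : gT) (x : V) : V := [ffun g => x (h * g)%g].

Lemma shift_inj h : injective (shift h).
Proof.
move=> x y /ffunP e; apply/ffunP => g.
by have := e (h^-1 * g)%g; rewrite !ffunE mulKVg.
Qed.

Definition shift_perm h : {perm V} := perm (@shift_inj h).

Lemma shift_permM : {morph shift_perm : h k / (h * k)%g}.
Proof.
move=> h k; apply/permP => x; rewrite permM !permE.
by apply/ffunP => g; rewrite !ffunE mulgA.
Qed.

Lemma translationD v w :
  translation (v + w) = (translation v * translation w)%g.
Proof. by apply/permP => x; rewrite permM !permE addrA. Qed.

Lemma translation0 : translation 0 = 1%g.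
Proof. by apply/permP => x; rewrite !permE addr0. Qed.

Lemma translation_inj : injective translation.
Proof. by move=> v w /permP/(_ 0); rewrite !permE !add0r. Qed.

Lemma shiftD h v w : shift h (v + w) = shift h v + shift h w.
Proof. by apply/ffunP => g; rewrite !ffunE. Qed.

Lemma translationJ v h :
  (translation v ^ shift_perm h)%g = translation (shift h v).
Proof.
rewrite conjgE; apply: (mulgI (shift_perm h)); rewrite mulKVg.
by apply/permP => x; rewrite !permM !permE shiftD.
Qed.

(** Commutators in the affine group are difference operators. *)
Lemma translation_commg v h :
  [~ translation v, shift_perm h]%g = translation (shift h v - v).
Proof.
rewrite commgEl translationJ; apply: (mulgI (translation v)).
by rewrite mulKVg -translationD addrC subrK.
Qed.

Lemma group_set_translations : group_set (translation @: [set: V]).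
Proof.
apply/group_setP; split; first by apply/imsetP; exists 0; rewrite ?translation0.
move=> _ _ /imsetP[v _ ->] /imsetP[w _ ->].
by rewrite -translationD; apply: imset_f.
Qed.

Definition translations : {group {perm V}} := Group group_set_translations.

Canonical shift_morphism := Morphism (D := [set: gT]) (in2W shift_permM).

Definition shifts : {group {perm V}} := (shift_morphism @* [set: gT])%G.

Lemma affine_nilpotent p : prime p -> (p.-nat q)%N -> (1 < q)%N ->
  (p.-group [set: gT])%g -> (nilpotent (translations <*> shifts))%g.
Proof.
move=> pp pq q1 pG; apply: (@pgroup_nil _ p).
have nV : (shifts \subset 'N(translations))%g.
  apply/fintype.subsetP => _ /morphimP[h _ _ ->]; rewrite inE.
  apply/fintype.subsetP => _ /imsetP[_ /imsetP[v _ ->] ->].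
  by rewrite translationJ; apply: imset_f.
rewrite /= (norm_joinEr nV) pgroupM morphim_pgroup // andbT /pgroup /=.
rewrite card_imset; last exact: translation_inj.
by rewrite cardsT card_ffun card_ord Zp_cast // pnatX pq.
Qed.

Definition difference_word (s : seq gT) (v : V) : V :=
  foldl (fun w h => shift h w - w) v s.

(** Differencing [n] times moves a translation to the term ['L_n.+1] of the
    lower central series of the affine group. *)
Lemma difference_word_nilpotent p : prime p -> (p.-nat q)%N -> (1 < q)%N ->
  (p.-group [set: gT])%g ->
  exists n, forall s v, size s = n -> difference_word s v = 0.
Proof.
move=> pp pq q1 pG; have := affine_nilpotent pp pq q1 pG.
set K := (_ <*> _)%g => /lcnP[n Ln]; exists n => s v sn.
have inL : translation (difference_word s v) \in ('L_(size s).+1(K))%g.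
  elim/last_ind: s {sn} => [|s h IH].
    by rewrite lcn1; apply/(fintype.subsetP (joing_subl _ _))/imset_f.
  rewrite size_rcons /difference_word foldl_rcons -/(difference_word s v).
  rewrite -translation_commg lcnSn; apply: mem_commg => //.
  apply/(fintype.subsetP (joing_subr _ _)).
  by apply: (mem_morphim shift_morphism); rewrite inE.
move: inL; rewrite sn Ln => /set1P; rewrite -translation0.
exact: translation_inj.
Qed.

End AffineGroup.

Section Words.
Variables (gT : finGroupType) (A : nzRingType) (phi : gT -> A).
Hypotheses (phi1 : phi 1%g = 1)
  (phiM : {morph phi : g h / (g * h)%g >-> g * h}).

(** The map sending a function [v] to the sum of [v g * phi g^-1] turns shifts
    by [h] into right multiplications by [phi h], and the indicator function of
    1 into 1.  The image of an iterated difference of the latter is thus the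
    product of the [phi h - 1]. *)
Lemma augmentation_word_nilpotent p a : prime p -> (p.-group [set: gT])%g ->
  p%:R ^+ a = 0 :> A ->
  exists n, forall s : seq gT, size s = n -> \prod_(h <- s) (phi h - 1) = 0.
Proof.
move=> pp pG pa.
(* The exponent a.+1 makes q > 1, so that 'Z_q has q elements, even if a = 0. *)
pose q := (p ^ a.+1)%N.
have q0 : q%:R = 0 :> A by rewrite natrX exprS pa mulr0.
have q1 : (1 < q)%N by rewrite -(expn0 p) ltn_exp2l // prime_gt1.
have [|n Hn] := @difference_word_nilpotent gT q p pp _ q1 pG.
  by rewrite pnatX pnat_id.
exists n => s sn.
pose L (v : {ffun gT -> 'Z_q}) : A := \sum_g (v g : nat)%:R * phi g^-1%g.
have Lshift h v : L (shift h v) = L v * phi h.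
  rewrite /L mulr_suml (reindex_inj (mulgI h^-1%g)) /=; apply: eq_bigr => g _.
  by rewrite ffunE mulKVg invMg invgK phiM mulrA.
have LD v w : L (v + w) = L v + L w.
  rewrite /L -big_split; apply: eq_bigr => g _ /=.
  rewrite -mulrDl; congr (_ * _).
  rewrite ffunE -natrD; apply: natr_eq_mod q0 _.
  have modq : (Zp_trunc q).+2 = q by apply: Zp_cast.
  have -> : nat_of_ord (v g + w g)%R = ((v g + w g) %% q)%N
    by rewrite -[RHS](congr1 (modn (v g + w g)%N) modq).
  exact: modn_mod.
have LB v w : L (v - w) = L v - L w.
  by apply/(addIr (L w)); rewrite -LD !subrK.
have Lw v t : L (difference_word t v) = L v * \prod_(h <- t) (phi h - 1).
  elim: t v => [|h t IH] v /=; first by rewrite big_nil mulr1.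
  by rewrite big_cons /difference_word /= IH LB Lshift mulrA mulrBr mulr1.
pose d : {ffun gT -> 'Z_q} := [ffun g => (g == 1%g)%:R].
have Ld : L d = 1.
  rewrite /L (bigD1 1%g) //= big1 ?addr0 => [|g g1].
    by rewrite ffunE eqxx invg1 phi1 mulr1 /= Zp_cast // modn_small.
  by rewrite ffunE (negbTE g1) mul0r.
rewrite -[LHS]mul1r -{1}Ld -Lw Hn //.
by rewrite /L big1 // => g _; rewrite ffunE mul0r.
Qed.

(** Powers of the sum expand into products of [phi g - 1] with coefficients,
    and the coefficients commute with the [phi h] although not with each
    other.  The induction replaces one factor of the power at a time. *)
Lemma augmentation_nilpotent p a (r : gT -> A) :
  prime p -> (p.-group [set: gT])%g ->
  p%:R ^+ a = 0 :> A -> (forall g h, GRing.comm (r g) (phi h)) ->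
  exists n, (\sum_g r g * (phi g - 1)) ^+ n = 0.
Proof.
move=> pp pG pa cr; have [n Hn] := augmentation_word_nilpotent pp pG pa.
exists n; set d := \sum_g _.
(* The coefficient r g is moved out to the right of the word. *)
suff kill k s : (k + size s)%N = n -> d ^+ k * \prod_(h <- s) (phi h - 1) = 0.
  by have := kill n [::]; rewrite addn0 big_nil mulr1; apply.
elim: k s => [|k IH] s; first by rewrite add0n expr0 mul1r; apply: Hn.
rewrite addSnnS => ks; rewrite exprSr -mulrA mulr_suml mulr_sumr big1 // => g _.
have cw : GRing.comm (r g) (\prod_(h <- g :: s) (phi h - 1)).
  by apply: commr_prod => h _; apply: commrB; [apply: cr|apply: commr1].
have ih := IH (g :: s) ks; rewrite big_cons in cw ih.
by rewrite -mulrA cw mulrA ih mul0r.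
Qed.

End Words.

(** * Finite subgroups of a locally finite group *)

Section FiniteSubgroup.
Variables (G : groupType) (t : seq G).

(** The closure proof is an argument of the type because the group operations
    are attached to the type. *)
Definition finite_subgroup (_ : subgroup (fun x => x \in t)) : Type :=
  seq_sub t.

Variable tP : subgroup (fun x => x \in t).
Local Notation T := (finite_subgroup tP).

HB.instance Definition _ := Finite.copy T (seq_sub t).

Lemma finite_subgroup_mem1 : (1%g \in t). Proof. by case: tP. Qed.
Lemma finite_subgroup_memM (x y : T) : (ssval x * ssval y)%g \in t.
Proof. by case: tP => _ M _; apply: M; apply: ssvalP. Qed.
Lemma finite_subgroup_memV (x : T) : (ssval x)^-1%g \in t.
Proof. by case: tP => _ _; apply; apply: ssvalP. Qed.

Definition finite_subgroup_mul (x y : T) : T :=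
  SeqSub (finite_subgroup_memM x y).
Definition finite_subgroup_one : T := SeqSub finite_subgroup_mem1.
Definition finite_subgroup_inv (x : T) : T := SeqSub (finite_subgroup_memV x).

Lemma finite_subgroup_mulA : associative finite_subgroup_mul.
Proof. by move=> x y z; apply: val_inj; rewrite /= mulgA. Qed.
Lemma finite_subgroup_mul1 : left_id finite_subgroup_one finite_subgroup_mul.
Proof. by move=> x; apply: val_inj; rewrite /= mul1g. Qed.
Lemma finite_subgroup_mulV :
  left_inverse finite_subgroup_one finite_subgroup_inv finite_subgroup_mul.
Proof. by move=> x; apply: val_inj; rewrite /= mulVg. Qed.

HB.instance Definition _ := Finite_isGroup.Build T
  finite_subgroup_mulA finite_subgroup_mul1 finite_subgroup_mulV.

Definition finite_subgroup_val (x : T) : G := ssval x.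

Lemma finite_subgroup_val1 : finite_subgroup_val 1%g = 1%g.
Proof. by []. Qed.

Lemma finite_subgroup_valM : {morph finite_subgroup_val : x y / (x * y)%g}.
Proof. by []. Qed.

Lemma finite_subgroup_val_inj : injective finite_subgroup_val.
Proof. exact: val_inj. Qed.

Lemma finite_subgroup_pgroup p : prime p -> is_qgroup G p ->
  (p.-group [set: T])%g.
Proof.
move=> pp pG; apply/pgroupP => q qp /(Cauchy qp)[x _ ox].
have [k [_ xk _]] := pG (finite_subgroup_val x).
have xk1 : (x ^+ (p ^ k) = 1)%g.
  apply: finite_subgroup_val_inj; rewrite finite_subgroup_val1 -xk.
  elim: (p ^ k)%N => [|n IH]; first by rewrite !expg0.
  by rewrite !expgS finite_subgroup_valM IH.
have : (q %| p ^ k)%N by rewrite -ox order_dvdn xk1.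
by rewrite Euclid_dvdX // => /andP[]; rewrite dvdn_prime2 // inE.
Qed.

End FiniteSubgroup.

(** Local finiteness gives a list that contains the generated subgroup; it is
    filtered down to that subgroup. *)
Lemma locally_finite_subgroup (G : groupType) (s : seq G) : locally_finite G ->
  exists t : seq G, subgroup (fun x => x \in t) /\ {subset s <= t}.
Proof.
move=> /(_ s)[t tP]; exists [seq x <- t | `[< Defs.generated s x >]].
have mem x :
    (x \in [seq x <- t | `[< Defs.generated s x >]]) <-> Defs.generated s x.
  rewrite mem_filter; split=> [/andP[/asboolP //]|gx].
  by apply/andP; split; [apply/asboolP|apply: tP].
split=> [|x sx]; last by apply/mem => H _; apply.
split=> [|x y /mem gx /mem gy|x /mem gx]; apply/mem => H HP Hs;
  have [H1 HM HV] := HP.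
- exact: H1.
- by apply: HM; [apply: gx|apply: gy].
- by apply: HV; apply: gx.
Qed.

(** * The augmentation of a group ring *)

Section GroupRing.
Variables (R : nzRingType) (G : groupType).
Local Notation RG := (group_ring R G).
Implicit Types (x y d : RG) (g h : G).

Definition gr_scalar (r : R) : RG := << r *g 1%g >>.
Definition gr_basis g : RG := << 1 *g g >>.
Definition augmentation x : R := \sum_(g <- msupp x) x@_g.

Lemma gr_mulE x y : x * y = gr_mul x y.
Proof. by []. Qed.

Lemma gr_scalar_zmod : zmod_morphism gr_scalar.
Proof. exact: monalgUB. Qed.

Lemma gr_scalar_monoid : monoid_morphism gr_scalar.
Proof. by split=> // r s; rewrite gr_mulE gr_mulUU mulg1. Qed.

HB.instance Definition _ :=
  GRing.isZmodMorphism.Build R RG gr_scalar gr_scalar_zmod.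
HB.instance Definition _ :=
  GRing.isMonoidMorphism.Build R RG gr_scalar gr_scalar_monoid.

Lemma gr_basis1 : gr_basis 1%g = 1. Proof. by []. Qed.

Lemma gr_basisM : {morph gr_basis : g h / (g * h)%g >-> g * h}.
Proof. by move=> g h; rewrite gr_mulE gr_mulUU mulr1. Qed.

Lemma gr_basisX g n : gr_basis (g ^+ n)%g = gr_basis g ^+ n.
Proof.
by elim: n => [|n IH]; rewrite ?gr_basis1 // expgS exprS gr_basisM IH.
Qed.

Lemma gr_basis_unit g : is_unit (gr_basis g).
Proof.
by exists (gr_basis g^-1%g); rewrite -!gr_basisM mulgV mulVg gr_basis1.
Qed.

Lemma gr_scalar_basis r g : gr_scalar r * gr_basis g = << r *g g >>.
Proof. by rewrite gr_mulE gr_mulUU mulr1 mul1g. Qed.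

Lemma gr_scalar_basis_comm r g : GRing.comm (gr_scalar r) (gr_basis g).
Proof. by rewrite /GRing.comm gr_scalar_basis gr_mulE gr_mulUU mul1r mulg1. Qed.

Lemma augmentationE (D : {fset G}) x : (msupp x `<=` D)%fset ->
  augmentation x = \sum_(g <- D) x@_g.
Proof. by move=> sD; apply: big_fset_incl => // g _ /mcoeff_outdom. Qed.

Lemma augmentationU r g : augmentation << r *g g >> = r.
Proof. by rewrite (augmentationE msuppU_le) big_seq_fset1 mcoeffUU. Qed.

Lemma augmentation_zmod : zmod_morphism augmentation.
Proof.
move=> x y; pose D := (msupp x `|` msupp y)%fset.
rewrite (@augmentationE D (x - y)) ?msuppB_le //.
rewrite (@augmentationE D x) ?fsubsetUl // (@augmentationE D y) ?fsubsetUr //.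
by rewrite -sumrB; apply: eq_bigr => g _; rewrite mcoeffB.
Qed.

HB.instance Definition _ :=
  GRing.isZmodMorphism.Build RG R augmentation augmentation_zmod.

Lemma augmentation_monoid : monoid_morphism augmentation.
Proof.
split=> [|x y]; first exact: augmentationU.
rewrite gr_mulE /gr_mul raddf_sum /= mulr_suml; apply: eq_bigr => g _.
by rewrite raddf_sum mulr_sumr; apply: eq_bigr => h _; exact: augmentationU.
Qed.

HB.instance Definition _ :=
  GRing.isMonoidMorphism.Build RG R augmentation augmentation_monoid.

Lemma augmentation_scalar r : augmentation (gr_scalar r) = r.
Proof. exact: augmentationU. Qed.

Lemma sum_seq_sub (W : zmodType) (t : seq G) (D : {fset G}) (F : G -> W) :
  {subset D <= t} -> (forall g, g \notin D -> F g = 0) ->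
  \sum_(x : seq_sub t) F (ssval x) = \sum_(g <- D) F g.
Proof.
move=> sD F0.
rewrite -(big_map (fun x : seq_sub t => ssval x) xpredT F).
rewrite (bigID [in D]) /= [X in _ + X]big1 ?addr0 => [|g /F0 //].
rewrite -big_filter; apply: perm_big; apply: uniq_perm => [||g].
- by rewrite filter_uniq // map_inj_uniq ?index_enum_uniq //; apply: val_inj.
- exact: fset_uniq.
rewrite mem_filter; case: (boolP (g \in D)) => //= gD.
by apply/mapP; exists (SeqSub (sD g gD)); rewrite // mem_index_enum.
Qed.

(** If the coefficients of [d] sum to 0, then [d] is the sum of the
    [d_h * (h - 1)] over the finite subgroup generated by its support. *)
Lemma augmentation_kernel_nil p a d : prime p -> locally_finite G ->
  is_qgroup G p -> p%:R ^+ a = 0 :> R -> augmentation d = 0 ->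
  exists n, d ^+ n = 0.
Proof.
move=> pp lfG pG pa d0.
have [t [tP st]] := locally_finite_subgroup (msupp d) lfG.
pose inG := @finite_subgroup_val G t tP.
pose phi (h : finite_subgroup tP) := gr_basis (inG h).
have := @augmentation_nilpotent (finite_subgroup tP) RG phi _ _ p a
  (fun h : finite_subgroup tP => gr_scalar (d@_(inG h))) pp.
case=> [||||g h|n dn].
- by [].
- by move=> x y; rewrite /phi /inG finite_subgroup_valM gr_basisM.
- exact: finite_subgroup_pgroup.
- by rewrite -(rmorph_nat gr_scalar) -rmorphXn pa rmorph0.
- exact: gr_scalar_basis_comm.
exists n; rewrite -[RHS]dn; congr (_ ^+ _).
under eq_bigr do rewrite mulrBr mulr1 gr_scalar_basis.
rewrite sumrB -[LHS]subr0; congr (_ - _).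
  rewrite [LHS]monalgE; apply/esym.
  apply: (sum_seq_sub (F := fun g => << d@_g *g g >>)) => // g.
  by move/mcoeff_outdom ->; rewrite monalgU0.
rewrite -raddf_sum /= -[LHS](rmorph0 gr_scalar); congr gr_scalar.
rewrite -[LHS]d0; apply/esym.
by apply: (sum_seq_sub (F := fun g => d@_g)) => // g /mcoeff_outdom.
Qed.

End GroupRing.

(** * Weakly sqrtJU group rings *)

Lemma trivial_qgroup (G : groupType) q : trivial_group G -> is_qgroup G q.
Proof.
move=> G1 x; exists 0%N; rewrite expn0; split=> //.
by move=> m; case: m => [|[]].
Qed.

Section Main.
Variables (R : nzRingType) (G : groupType).
Local Notation RG := (group_ring R G).

Lemma weakly_sqrtJU_group_ring p a : prime p -> locally_finite G ->
  is_qgroup G p -> p%:R ^+ a = 0 :> R -> weakly_sqrtJU R -> weakly_sqrtJU RG.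
Proof.
move=> pp lfG pG pa; apply: (weakly_sqrtJU_lift (f := @augmentation R G)).
  by move=> r; exists (gr_scalar G r); apply: augmentation_scalar.
by move=> d; apply: augmentation_kernel_nil pa.
Qed.

Lemma weakly_sqrtJU_group_ring_trivial : trivial_group G ->
  weakly_sqrtJU R -> weakly_sqrtJU RG.
Proof.
move=> G1; apply: (weakly_sqrtJU_lift (f := @augmentation R G)).
  by move=> r; exists (gr_scalar G r); apply: augmentation_scalar.
move=> d d0; exists 1%N; rewrite expr1; apply/malgP => g.
rewrite mcoeff0 -[RHS]d0 /=.
rewrite (@augmentationE _ _ [fset g]%fset) ?big_seq_fset1 //.
by apply/fsubsetP => h _; rewrite inE (G1 h) (G1 g).
Qed.

(** Constants split the augmentation, so units of [R] lift. *)
Lemma weakly_sqrtJU_coef : weakly_sqrtJU RG -> weakly_sqrtJU R.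
Proof.
apply: (weakly_sqrtJU_push (f := @augmentation R G)).
  by move=> r; exists (gr_scalar G r); apply: augmentation_scalar.
move=> u [v [uv vu]]; exists (gr_scalar G u); last exact: augmentation_scalar.
by exists (gr_scalar G v); rewrite -!rmorphM uv vu rmorph1.
Qed.

Lemma gr_scalar_central (f : R) : (forall r, GRing.comm f r) ->
  forall x : RG, GRing.comm (gr_scalar G f) x.
Proof.
move=> cf x; rewrite (monalgE x); apply: commr_sum => g _.
by rewrite /GRing.comm !gr_mulE !gr_mulUU mul1g mulg1 cf.
Qed.

(** The unit [g] is congruent to 1 or -1, up to elements that are nilpotent
    modulo the radical.  For [q = 3] the sign is absorbed into the root of unity
    [u = g] or [u = - g], whose order divides [2 * p ^ k], prime to 3.  For
    [q = 2] it is irrelevant, since 2 is in the radical on the factor of [f];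
    then [u = g] has odd order.  In both cases [f * u = f], and the coefficient
    of this at 1 is [0 = f]. *)
Lemma torsion_idempotent_zero (p q c k : nat) (f : R) (g : G) :
  weakly_sqrtJU RG -> prime p -> p != q -> ((q == 2) || (q == 3))%N ->
  central_idempotent f -> q%:R ^+ c * f = 0 ->
  g <> 1%g -> (g ^+ (p ^ k))%g = 1%g -> f = 0.
Proof.
move=> /weakly_sqrtJUP W pp pq q23 [cf ff] qf g1 gm.
have [s Ss] := W _ (gr_basis_unit R g).
pose F := gr_scalar G f.
have cF : forall x, GRing.comm F x := gr_scalar_central cf.
have FF : F * F = F by rewrite -rmorphM ff.
have qF : (q ^ c)%:R * F = 0.
  by rewrite natrX -(rmorph_nat (gr_scalar G)) -rmorphXn -rmorphM qf rmorph0.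
have bm : gr_basis R g ^+ (p ^ k) = 1 by rewrite -gr_basisX gm gr_basis1.
have [t [m [com um Su]]] : exists (t : bool) m, [/\ coprime (q ^ c) m,
    ((-1) ^+ t * gr_basis R g) ^+ m = 1 &
    sqrt_jacobson (F * ((-1) ^+ t * gr_basis R g - 1))].
  have SF : sqrt_jacobson (F * (gr_basis R g - (-1) ^+ s)).
    by rewrite cF; apply: sqrt_jacobsonM Ss; apply/commr_sym/cF.
  have qp : prime q by case/orP: q23 => /eqP ->.
  have cqp : coprime (q ^ c) (p ^ k).
    by rewrite coprimeXl // coprimeXr // prime_coprime // dvdn_prime2 // eq_sym.
  case/orP: q23 => /eqP eq.
    exists false, (p ^ k)%N; split=> //; rewrite expr0 mul1r //.
    have -> : F * (gr_basis R g - 1) =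
      F * (gr_basis R g - (-1) ^+ s) + F * ((-1) ^+ s - 1).
      by rewrite -mulrDr addrA subrK.
    apply: sqrt_jacobsonD => //; case: s {Ss SF}; last first.
      by rewrite expr0 subrr mulr0; apply: jacobson0.
    rewrite expr1 -opprD -mulr2n mulrN; apply: jacobsonN.
    apply: central_sqrt_jacobson.
      move=> x; apply/commr_sym/commrM; first exact/commr_sym/cF.
      exact: (commr_nat x 2).
    apply: (@nilpotent_sqrt_jacobson _ _ c.+1).
    rewrite exprMn_comm; last exact: cF.
    by rewrite exprSr -mulrA cF exprS -mulrA -natrX -eq qF !mulr0.
  exists s, (2 * p ^ k)%N; split.
  - by rewrite coprimeMr cqp andbT coprimeXl // eq.
  - rewrite exprM exprMn_comm; last exact/commr_sym/commr_sign.
    by rewrite sqrr_sign mul1r -exprM mulnC exprM bm expr1n.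
  - have -> : (-1) ^+ s * gr_basis R g - 1 =
      (-1) ^+ s * (gr_basis R g - (-1) ^+ s).
      by rewrite mulrBr -expr2 sqrr_sign.
    rewrite mulrA cF -mulrA; move: SF; case: (s) => SF; last by rewrite mul1r.
    by rewrite expr1 mulN1r; apply: sqrt_jacobsonN.
have [l lm] := idempotent_inverse com qF.
have := root_of_unity_sqrt_jacobson cF FF um lm Su.
rewrite mulrBr mulr1 => /eqP; rewrite subr_eq0 => /eqP /(congr1 (mcoeff 1%g)).
rewrite mulrA [F * _]cF -mulrA gr_scalar_basis [RHS]mcoeffUU => <-.
have z : (<< f *g g >> : RG)@_1%g = 0.
  by rewrite mcoeffU; move/eqP: g1 => /negbTE ->.
by case: (t); rewrite ?expr1 ?expr0 ?mul1r // mulN1r mcoeffN z oppr0.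
Qed.

End Main.

Theorem theorem3p5 (p : nat) (R : nzRingType) (G : groupType)
  (p_prime : prime p)
  (charR : positive_characteristic R)
  (lfG : locally_finite G)
  (pG : is_qgroup G p) :
  weakly_sqrtJU (group_ring R G) <->
  [\/ sqrtJU R /\ is_qgroup G 2,
      [/\ weakly_sqrtJU R, jacobson (3%:R : R) & is_qgroup G 3] |
      exists (R1 R2 : nzRingType) (f : {rmorphism R -> (R1 * R2)%type}),
        [/\ bijective f, sqrtJU R1, weakly_sqrtJU R2 & trivial_group G]].
Proof.
split=> [W|]; last first.
  case=> [[S G2]|[W J3 G3]|[R1 [R2 [f [[f' fK Kf] S W G1]]]]].
  - have WR := sqrtJU_weakly S; have J2 := sqrtJU_jacobson2 S.
    have [a ea] := prime_jacobson_nilpotent (isT : prime 2) charR J2.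
    exact: weakly_sqrtJU_group_ring (isT : prime 2) lfG G2 ea WR.
  - have [a ea] := prime_jacobson_nilpotent (isT : prime 3) charR J3.
    exact: weakly_sqrtJU_group_ring (isT : prime 3) lfG G3 ea W.
  - apply: (weakly_sqrtJU_group_ring_trivial G1).
    apply: (weakly_sqrtJU_lift (f := f)); last exact: weakly_sqrtJU_prod.
      by move=> y; exists (f' y); apply: Kf.
    by move=> d d0; exists 1%N; rewrite expr1 -[d]fK d0 -(rmorph0 f) fK.
have WR := weakly_sqrtJU_coef W.
have [a [b ab]] := weakly_sqrtJU_char charR WR.
have co : coprime (2 ^ a) (3 ^ b) by rewrite coprimeXl // coprimeXr.
have [n [n2 n3 nn]] := coprime_idempotent co ab.
(* 2 is nilpotent on the part of R cut out by e, and 3 on the other part. *)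
set e : R := n%:R in n2 n3 nn.
have ec : central_idempotent e by split=> // x; apply: commr_natl.
have fc := central_idempotentC ec.
have case2 : 1 - e = 0 -> sqrtJU R.
  move=> /eqP; rewrite subr_eq0 => /eqP e1; rewrite -e1 mulr1 in n2.
  exact: weakly_sqrtJU_jacobson2 WR (nilpotent_nat_jacobson n2).
have case3 : e = 0 -> jacobson (3%:R : R).
  by move=> e0; rewrite e0 subr0 mulr1 in n3; apply: nilpotent_nat_jacobson n3.
have [G1|] := pselect (trivial_group G).
  have [e0|e0] := pselect (e = 0).
    by apply: Or32; split; [|exact: case3|exact: trivial_qgroup].
  have [f0|f0] := pselect (1 - e = 0).
    by apply: Or31; split; [exact: case2|exact: trivial_qgroup].
  apply: Or33; have [f fbij] := corner_decomposition ec e0 fc f0.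
  exists (corner ec e0), (corner fc f0), f.
  split=> //; last exact: corner_weakly.
  apply: weakly_sqrtJU_jacobson2 (corner_weakly WR) _.
  by apply: (@nilpotent_nat_jacobson _ 2 a); apply: corner_natr0.
move=> /existsNP[g g1]; have [k [_ gk _]] := pG g.
have e0 : p != 2%N -> e = 0.
  move=> p2.
  apply: (torsion_idempotent_zero (c := a) W p_prime p2 _ ec _ g1 gk);
    by rewrite -?natrX.
have f0 : p != 3%N -> 1 - e = 0.
  move=> p3.
  apply: (torsion_idempotent_zero (c := b) W p_prime p3 _ fc _ g1 gk);
    by rewrite -?natrX.
have [p2|p2] := eqVneq p 2%N.
  by apply: Or31; rewrite -p2; split=> //; apply/case2/f0; rewrite p2.
have [p3|p3] := eqVneq p 3%N.
  by apply: Or32; split; [|exact: case3 (e0 p2)|rewrite -p3].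
have := f0 p3; rewrite e0 // subr0 => /eqP; by rewrite oner_eq0.
Qed.
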